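(* Let $n \ge 12$ be an integer. If $G$ is a graph with $n$ vertices and $2n-4$ edges, then $a(G) \le 2$. Consequently, $\alpha(n, 2n-4) = 2$.
   Context: All graphs are finite, simple and undirected. For a graph $G$, let $A(G)$ be its adjacency matrix, $D(G)$ the diagonal matrix of vertex degrees, and $L(G) = D(G) - A(G)$ its Laplacian matrix. The eigenvalues of $L(G)$, counted with multiplicity, are $0 = a_1(G) \le a_2(G) \le \cdots \le a_n(G)$, where $n = |V(G)|$. The algebraic connectivity of $G$ is $a(G) = a_2(G)$. For positive integers $n, m$, $\alpha(n,m)$ denotes the maximum of $a(G)$ over all graphs $G$ with $n$ vertices and $m$ edges. *)

(* Defs.v *)
From HB Require Import structures.
From mathcomp Require Import all_boot all_order all_algebra.
From mathcomp Require Import polyrcf.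

Set Implicit Arguments.
Unset Strict Implicit.
Unset Printing Implicit Defensive.

Import Order.TTheory GRing.Theory Num.Theory.

Local Open Scope ring_scope.

Record sgraph : Type := SGraph {
  vertex :> finType;
  adj : rel vertex;
  adj_sym : symmetric adj;
  adj_irrefl : irreflexive adj
}.

Definition edges (G : sgraph) : {set {set G}} :=
  [set [set x; y] | x in G, y in G & adj x y].

Definition degree (G : sgraph) (x : G) : nat := #|[set y | adj x y]|.

Section Laplacian.

Variables (R : rcfType) (G : sgraph).

Definition adjacency_mx : 'M[R]_#|G| :=
  \matrix_(i, j) (adj (enum_val i) (enum_val j))%:R.

Definition degree_mx : 'M[R]_#|G| :=
  diag_mx (\row_i (degree (enum_val i))%:R).

Definition laplacian_mx : 'M[R]_#|G| := degree_mx - adjacency_mx.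

End Laplacian.

(* [rootsR p] lists the distinct roots of [p] in the real closed field [R].
   The eigenvalues of a real symmetric matrix all lie in [R], so for such a
   matrix of size [n] the sequence below has exactly [n] entries. *)
Definition eigenvalues (R : rcfType) (n : nat) (A : 'M[R]_n) : seq R :=
  let p := char_poly A in
  sort <=%R (flatten [seq nseq (mup x p) x | x <- rootsR p]).

(* Indices start at 0, so this is the second smallest eigenvalue.  With fewer
   than two vertices it takes the default value 0. *)
Definition algebraic_connectivity (R : rcfType) (G : sgraph) : R :=
  (eigenvalues (laplacian_mx R G))`_1.

(* [is_alpha n m v] says that the maximum defining alpha(n, m) exists and
   equals [v]. *)
Definition is_alpha (R : rcfType) (n m : nat) (v : R) : Prop :=
  (exists G : sgraph,
     [/\ #|G| = n, #|edges G| = m & algebraic_connectivity R G = v]) /\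
  (forall G : sgraph,
     #|G| = n -> #|edges G| = m -> algebraic_connectivity R G <= v).

(* Main.v *)
Require Import Defs.
From mathcomp Require Import all_boot all_order all_algebra.
From mathcomp Require Import complex polyrcf spectral sesquilinear.
From mathcomp Require Import ring lra zify.

Import Order.TTheory GRing.Theory Num.Theory.
Local Open Scope ring_scope.

(** Write Q for the quadratic form of L - 2.  If [Q] is nonpositive on a plane, that
plane meets the hyperplane orthogonal to the constant vector, so [a(G) <= 2];
hence [a(G) > 2] forces, for any two independent vectors p, q with
[Q(p) <= 0] and [Q(q) <= 0], the strict inequality [Q(p) Q(q) < Q(p, q)^2]
([connectivity_gap2]).  The theorem comes from playing such pairs of vectors
against the edge count, by which the degrees add up to only [4 n - 8].

Taking for p and q the indicators of two sets that are not joined by an edge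
shows that every degree is at least 3 ([gap2_min_degree]) and, once n is at
least 12, that no two cubic vertices (vertices of degree 3) are adjacent
([gap2_cubic_independent]).  Let C be the set of cubic vertices.  Every cubic
vertex now has its three neighbours outside C, and the variables on C can be
eliminated: for u outside C, the vector [star u], which is 1 at u and at the
cubic neighbours of u, is Q-orthogonal to every coordinate vector of C.  On
these stars Q reads [Q(star u) = beta u - 2] and
[Q(star u, star w) = - link u w], where [beta u] is the number of noncubic
neighbours of u and [link u w] is the number of walks from u to w of length 1, or
of length 2 through C ([gform_star]).

So [low] vertices ([beta <= 2]) have a nonpositive star, and so has the sum of
the stars of two [single] vertices ([beta = 3], one cubic neighbour) that share
that neighbour.  Any two of these vectors must be linked.  Therefore low
vertices are pairwise linked, and multiply so if both have beta at most 1
([link_low]);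
every low vertex w is adjacent to some single neighbour of each [busy] cubic
vertex (one with at least two single neighbours) that is not adjacent to w, which
w can afford at most [beta w] times ([low_degree]); and two busy vertices have
adjacent single neighbours, so that there are at most seven busy vertices
([card_busy]).

On the other side, with [t u] the number of cubic neighbours of u, the edge count
reads: the sum over u outside C of [8 - 2 beta u - t u] equals [16 + #|C|]
([sum_noncubic]).  A vertex that is not low contributes at most 1, and
contributes 1 only if it is single, so the required surplus of 16 must come from
low vertices and busy vertices ([deficiency_low]).  The bound on busy vertices
forces at least three low vertices ([low_size]), and then the q low vertices are
so tightly linked that counting their links twice gives, in the end,
[48 <= q (13 - q) + r (3 - r) + x (3 - x) <= 46], where r and x count the low
vertices with beta at most 1 and equal to 0 ([counting_contradiction]).

The value 2 is attained by the complete bipartite graph with sides 2 and n - 2. *)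

Set Implicit Arguments.
Unset Strict Implicit.
Unset Printing Implicit Defensive.

(** * The second smallest eigenvalue of a real symmetric matrix *)

Local Notation "M ^t*" := (map_mx Num.conj (M^T)) (at level 30).
Local Notation toC := (real_complex _).

Lemma eigenvalues_prod (R : rcfType) n (A : 'M[R]_n) (s : seq R) :
  char_poly A = \prod_(x <- s) ('X - x%:P) ->
  eigenvalues A = sort <=%R s.
Proof.
move=> cA; rewrite /eigenvalues cA.
set p := \prod_(x <- s) _.
have p0 : p != 0 by rewrite monic_neq0 // monic_prod_XsubC.
apply/perm_sort_leP.
rewrite -(permPr (perm_count_undup s)).
have -> : [seq nseq (count_mem x s) x | x <- undup s]
    = [seq nseq (mup x p) x | x <- undup s].
  by apply: eq_map => x; rewrite /p mu_prod_XsubC.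
apply/perm_flatten/perm_map/uniq_perm.
- exact: uniq_roots.
- exact: undup_uniq.
move=> x; rewrite mem_undup -(root_prod_XsubC s) -/p.
by have := roots_on_rootsR p0 x; rewrite in_itv /= => ->.
Qed.

Lemma char_poly_conj (F : fieldType) n (P D : 'M[F]_n) :
  P \in unitmx -> char_poly (invmx P *m D *m P) = char_poly D.
Proof.
move=> uP.
have uPp : map_mx polyC P \in unitmx by rewrite map_unitmx.
have -> : char_poly (invmx P *m D *m P) =
   \det (map_mx polyC (invmx P) *m char_poly_mx D *m map_mx polyC P).
  congr (\det _); rewrite /char_poly_mx !map_mxM mulmxBr mulmxBl.
  rewrite scalar_mxC; congr (_ - _).
  by rewrite -mulmxA -map_mxM mulVmx // map_mx1 mulmx1.
rewrite !det_mulmx mulrAC -det_mulmx -map_mxM mulVmx //.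
by rewrite map_mx1 det1 mul1r.
Qed.

(** The spectral theorem is available over an algebraically closed field with
conjugation, so the unitary matrix P is taken over [R[i]]; the eigenvalues of a
symmetric matrix are real, and they are kept as elements of [R]. *)
Lemma symmetric_diagonalization (R : rcfType) n (A : 'M[R]_n) : A^T = A ->
  exists (P : 'M[R[i]]_n) (d : 'I_n -> R),
    [/\ P *m P ^t* = 1%:M,
        map_mx toC A = P ^t* *m diag_mx (\row_i toC (d i)) *m P
      & eigenvalues A = sort <=%R [seq d i | i : 'I_n]].
Proof.
move=> symA; pose B := map_mx toC A.
have hB : B \is hermsymmx.
  apply: realsym_hermsym.
    apply/is_hermitianmxP; rewrite expr0 scale1r map_mx_id //.
    by rewrite /B map_trmx symA.
  by apply/mxOverP => i j; rewrite mxE; apply/complex_realP; exists (A i j).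
have /orthomx_spectralP BE := hermitian_normalmx hB.
have dreal := hermitian_spectral_diag_real hB.
have uP := spectral_unitarymx B.
exists (spectralmx B), (fun i => complex.Re (spectral_diag B 0 i)).
set D := (\row_i _).
have DE : D = spectral_diag B.
  by apply/rowP => i; rewrite mxE RRe_real //; apply/mxOverP.
split.
- exact/unitarymxP.
- by rewrite DE -invmx_unitary.
apply: eigenvalues_prod.
apply: (map_inj_poly (@complexI R)); first exact: rmorph0.
rewrite map_char_poly /= -/B {1}BE char_poly_conj ?unitarymx_unit //.
rewrite char_poly_trig ?diag_mx_is_trig // big_image /= rmorph_prod /=.
apply: eq_bigr => i _; rewrite rmorphB /= map_polyX map_polyC /=.
by rewrite -DE !mxE eqxx mulr1n.
Qed.

Definition mxform (R : pzRingType) n (A : 'M[R]_n) (x : 'rV[R]_n) : R :=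
  (x *m A *m x^T) 0 0.

(** A complex vector [a + i b] has the real form value [Q(a) + Q(b)], because A is
symmetric and the cross terms cancel.  Bounds of Q on real vectors therefore
transfer to the complex vectors on which A is diagonal. *)
Lemma mxform_spectral (R : rcfType) n (A : 'M[R]_n) (P : 'M[R[i]]_n) (d : 'I_n -> R)
    (c : R) (a b : 'rV[R]_n) :
  A^T = A -> P *m P ^t* = 1%:M ->
  map_mx toC A = P ^t* *m diag_mx (\row_i toC (d i)) *m P ->
  let z := map_mx toC a + 'i%C *: map_mx toC b in
  toC (mxform (A - c%:M) a + mxform (A - c%:M) b) =
  \sum_i toC (d i - c) * `|(z *m P ^t*) 0 i| ^+ 2.
Proof.
move=> symA PP AE z.
pose B := A - c%:M.
have symB : B^T = B by rewrite /B linearB /= symA tr_scalar_mx.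
have BE : map_mx toC B = P ^t* *m diag_mx (\row_i toC (d i - c)) *m P.
  have -> : diag_mx (\row_i toC (d i - c)) = diag_mx (\row_i toC (d i)) - (toC c)%:M.
    apply/matrixP => i j; rewrite !mxE rmorphB /=.
    by case: eqP => _; rewrite ?mulr1n ?mulr0n ?subr0.
  rewrite mulmxBr mulmxBl -AE scalar_mxC -mulmxA (mulmx1C PP) mulmx1.
  by rewrite map_mxB map_scalar_mx.
have -> : \sum_i toC (d i - c) * `|(z *m P ^t*) 0 i| ^+ 2 =
          (z *m map_mx toC B *m z ^t*) 0 0.
  rewrite BE; set w := z *m P ^t*.
  have -> : z *m (P ^t* *m diag_mx (\row_i toC (d i - c)) *m P) *m z ^t* =
            w *m diag_mx (\row_i toC (d i - c)) *m w ^t*.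
    rewrite /w !mulmxA -!mulmxA; do 3 congr (_ *m _).
    by rewrite trmx_mul map_mxM trmxCK.
  rewrite mxE; apply: eq_bigr => i _.
  by rewrite mul_mx_diag !mxE normCK mulrA [_ * toC _]mulrC.
rewrite /mxform -/B.
have -> : z ^t* = map_mx toC a^T - 'i%C *: map_mx toC b^T.
  apply/matrixP => i j; rewrite !mxE rmorphD rmorphM /=.
  have conjR (x : R) : Num.conj (toC x) = toC x.
    by apply/CrealP/complex_realP; exists x.
  by rewrite !conjR conjCi mulNr.
have sw : (a *m B *m b^T) = (b *m B *m a^T).
  rewrite [LHS]mx11_scalar [RHS]mx11_scalar; congr (_%:M).
  rewrite -[in LHS](trmxK (a *m B *m b^T)) [in LHS]mxE.
  by rewrite !trmx_mul trmxK symB mulmxA.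
have iC : 'i%C * 'i%C = -1 :> R[i] by rewrite -expr2 sqr_i.
clearbody B; rewrite mulmxDl !mulmxBr !mulmxDl -!scalemxAr -!scalemxAl -!map_mxM sw.
rewrite scalerA iC scaleN1r opprD opprK addrA addrK -map_mxD [RHS]mxE.
by congr (toC _); rewrite [RHS]mxE.
Qed.

Lemma linear_relation2 (F : fieldType) (k l : F) :
  exists a b : F, ((a != 0) || (b != 0)) /\ a * k + b * l = 0.
Proof.
have [k0|k0] := eqVneq k 0.
  by exists 1, 0; rewrite oner_eq0 k0 mulr0 mul0r addr0.
by exists (- l), k; rewrite k0 orbT mulNr mulrC addNr.
Qed.

Lemma complexE2 (R : rcfType) (x : R[i]) :
  x = toC (complex.Re x) + 'i%C * toC (complex.Im x).
Proof. by case: x => x y; simpc. Qed.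

Lemma count_codom (T : finType) (S : Type) (f : T -> S) (a : pred S) :
  count a [seq f i | i : T] = #|[pred i | a (f i)]|.
Proof.
rewrite /image_mem count_map -size_filter cardE; congr size.
by rewrite [in RHS]/enum_mem -enumT; apply: eq_filter.
Qed.

Lemma toC_ge0 (R : rcfType) (x : R) : (0 <= toC x :> R[i]) = (0 <= x).
Proof. by rewrite (lecR 0 x). Qed.

Lemma real_imag_eq0 (R : rcfType) n (a b : 'rV[R]_n) :
  map_mx toC a + 'i%C *: map_mx toC b = 0 -> a = 0 /\ b = 0.
Proof.
move=> h; have e i : a 0 i = 0 /\ b 0 i = 0.
  have := congr1 (fun M : 'rV_n => M 0 i) h; rewrite !mxE; simpc.
  by case=> -> ->.
by split; apply/rowP => i; rewrite mxE; case: (e i).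
Qed.

(** Courant-Fischer, upper bound: if at most one eigenvalue were at most c, some
nonzero vector of the complex plane spanned by p and q would have no component
along the corresponding eigenvector, and the form of [A - c] would be positive there. *)
Lemma second_eigenvalue_le (R : rcfType) n (A : 'M[R]_n) (c : R) (p q : 'rV[R]_n) :
  A^T = A ->
  (forall a b : R, a *: p + b *: q = 0 -> a = 0 /\ b = 0) ->
  (forall a b : R, mxform (A - c%:M) (a *: p + b *: q) <= 0) ->
  (eigenvalues A)`_1 <= c.
Proof.
move=> symA indep neg.
have [P [d [PP AE ->]]] := symmetric_diagonalization symA.
set s := [seq d i | i : 'I_n].
rewrite leNgt; apply/negP => lt_c.
have : (count (<= c)%R s <= 1)%N.
  rewrite leqNgt; apply/negP => h.
  have : (sort <=%R s)`_1 <= c.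
    apply: nth_count_le; first exact: sort_le_sorted.
    by rewrite (permP (permEl (perm_sort _ _))).
  by rewrite leNgt lt_c.
rewrite count_codom => /card_le1_eqP le1.
(* the coordinate along the only eigenvector whose eigenvalue is at most c *)
pose phi (w : 'rV[R[i]]_n) := if [pick i | d i <= c] is Some i then w 0 i else 0.
have phiP w i : phi w = 0 -> d i <= c -> w 0 i = 0.
  rewrite /phi; case: pickP => [j dj w0 di|/(_ i)-> //].
  by rewrite (le1 j i).
have phiD x y u v : phi (x *: u + y *: v) = x * phi u + y * phi v.
  by rewrite /phi; case: pickP => [j _|_]; rewrite ?mxE ?mulr0 ?addr0.
have [x [y [xy0 rel]]] :=
  linear_relation2 (phi (map_mx toC p *m P ^t*)) (phi (map_mx toC q *m P ^t*)).
pose a := complex.Re x *: p + complex.Re y *: q.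
pose b := complex.Im x *: p + complex.Im y *: q.
pose z := map_mx toC a + 'i%C *: map_mx toC b.
have zE : z = x *: map_mx toC p + y *: map_mx toC q.
  apply/matrixP => i j; rewrite !mxE [in RHS](complexE2 x) [in RHS](complexE2 y).
  by rewrite !rmorphD !rmorphM; ring.
have w0 : phi (z *m P ^t*) = 0.
  by rewrite zE mulmxDl -!scalemxAl phiD.
have /esym := mxform_spectral c a b symA PP AE; rewrite -/z /= => sumE.
have term_ge0 i : 0 <= toC (d i - c) * `|(z *m P ^t*) 0 i| ^+ 2.
  have [di|di] := lerP (d i) c.
    by rewrite (phiP _ i w0 di) normr0 expr0n mulr0.
  by rewrite mulr_ge0 ?exprn_ge0 // toC_ge0 subr_ge0 ltW.
have form_le0 : mxform (A - c%:M) a + mxform (A - c%:M) b <= 0.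
  by rewrite -oppr_ge0 opprD addr_ge0 // oppr_ge0 neg.
have sum0 : \sum_i toC (d i - c) * `|(z *m P ^t*) 0 i| ^+ 2 = 0.
  apply/eqP; rewrite eq_le sumr_ge0 // andbT sumE -oppr_ge0 -rmorphN toC_ge0.
  by rewrite oppr_ge0.
have z0 : z = 0.
  suff w0' : z *m P ^t* = 0 by rewrite -[z]mulmx1 -(mulmx1C PP) mulmxA w0' mul0mx.
  apply/rowP => i; rewrite [RHS]mxE.
  have [di|di] := lerP (d i) c; first exact: phiP w0 di.
  have /(_ i isT)/eqP := psumr_eq0P (fun i _ => term_ge0 i) sum0.
  rewrite mulf_eq0 expf_eq0 /= normr_eq0 => /orP[|/eqP//].
  by rewrite fmorph_eq0 subr_eq0 => /eqP di'; rewrite di' ltxx in di.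
have [/indep[ax ay] /indep[bx by_]] := real_imag_eq0 z0.
by move: xy0; rewrite (complexE2 x) (complexE2 y) ax ay bx by_ !rmorph0 mulr0 addr0 eqxx.
Qed.

(** Courant-Fischer, lower bound: two eigenvalues below c would span a plane on
which the form of [A - c] is negative, and this plane contains a nonzero vector
orthogonal to v. *)
Lemma second_eigenvalue_ge (R : rcfType) n (A : 'M[R]_n) (c : R) (v : 'rV[R]_n) :
  (1 < n)%N -> A^T = A ->
  (forall x : 'rV[R]_n, (x *m v^T) 0 0 = 0 -> 0 <= mxform (A - c%:M) x) ->
  c <= (eigenvalues A)`_1.
Proof.
move=> n1 symA pos.
have [P [d [PP AE ->]]] := symmetric_diagonalization symA.
set s := [seq d i | i : 'I_n].
apply: nth_count_ge; first exact: sort_le_sorted.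
rewrite size_sort size_image card_ord n1 andbT.
rewrite (permP (permEl (perm_sort _ _))) leqNgt count_codom.
apply/negP => /card_gt1P[i [j [/= di dj ij]]].
have [x [y [xy0 rel]]] := linear_relation2 ((P *m (map_mx toC v)^T) i 0)
  ((P *m (map_mx toC v)^T) j 0).
pose w := x *: delta_mx 0 i + y *: delta_mx 0 j : 'rV[R[i]]_n.
pose z := w *m P.
pose a := map_mx (@complex.Re R) z; pose b := map_mx (@complex.Im R) z.
have zE : z = map_mx toC a + 'i%C *: map_mx toC b.
  by apply/matrixP => k l; rewrite !mxE -complexE2.
have zv : z *m (map_mx toC v)^T = 0.
  apply/matrixP => k l; rewrite !ord1 /z -mulmxA mulmxDl -!scalemxAl -!rowE.
  by rewrite !mxE in rel *.
have /real_imag_eq0[av bv] : map_mx toC (a *m v^T) + 'i%C *: map_mx toC (b *m v^T) = 0.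
  by rewrite !map_mxM scalemxAl -mulmxDl -zE -map_trmx.
have := mxform_spectral c a b symA PP AE; rewrite /= -zE /z -mulmxA PP mulmx1.
have wi : w 0 i = x by rewrite !mxE !eqxx /= (negPf ij) mulr1 mulr0 addr0.
have wj : w 0 j = y by rewrite !mxE !eqxx /= eq_sym (negPf ij) mulr1 mulr0 add0r.
rewrite (bigD1 i) //= (bigD1 j) 1?eq_sym //= big1 ?addr0; last first.
  move=> k /andP[ki kj].
  by rewrite !mxE eqxx /= (negPf ki) (negPf kj) !mulr0 addr0 normr0 expr0n mulr0.
rewrite wi wj => E.
have : 0 <= toC (mxform (A - c%:M) a + mxform (A - c%:M) b).
  by rewrite toC_ge0 addr_ge0 // pos // ?av ?bv mxE.
rewrite E => ge0.
have neg k (u : R[i]) : d k < c -> toC (d k - c) * `|u| ^+ 2 <= 0 ?= iff (u == 0).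
  move=> dk; have k0 : toC (d k - c) < 0 by rewrite (ltcR _ 0) subr_lt0.
  split; first by rewrite mulr_le0_ge0 ?exprn_ge0 // ltW.
  by rewrite mulf_eq0 (lt_eqF k0) orFb expf_eq0 andTb; apply: normr_eq0.
have := leifD (neg _ x di) (neg _ y dj); rewrite addr0 => h.
by have := lt_leif h; rewrite negb_and xy0 => /lt_geF; rewrite ge0.
Qed.

(** * The quadratic form of the Laplacian minus two *)

(** The value at x of (L - 2) q. *)
Definition lap2 (R : pzRingType) (G : sgraph) (q : G -> R) (x : G) : R :=
  ((degree x)%:R - 2) * q x - \sum_(y | adj x y) q y.

Definition gform (R : pzRingType) (G : sgraph) (p q : G -> R) : R :=
  \sum_x p x * lap2 q x.

Lemma laplacian_sym (R : rcfType) (G : sgraph) :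
  (laplacian_mx R G)^T = laplacian_mx R G.
Proof.
rewrite /laplacian_mx linearB /= tr_diag_mx; congr (_ - _).
by apply/matrixP => i j; rewrite !mxE adj_sym.
Qed.

Lemma laplacian_form (R : rcfType) (G : sgraph) (p q : 'rV[R]_#|G|) :
  (p *m (laplacian_mx R G - 2%:M) *m q^T) 0 0 =
  gform (fun x => p 0 (enum_rank x)) (fun x => q 0 (enum_rank x)).
Proof.
rewrite /gform -mulmxA mxE (reindex _ (onW_bij _ (@enum_rank_bij G))).
apply: eq_bigr => x _; congr (_ * _).
rewrite /lap2 /laplacian_mx /degree_mx mulmxBl mul_scalar_mx mulmxBl.
rewrite mul_diag_mx !mxE enum_rankK mulrBl addrAC; congr (_ - _).
rewrite (reindex _ (onW_bij _ (@enum_rank_bij G))) [RHS]big_mkcond /=.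
apply: eq_bigr => y _; rewrite !mxE !enum_rankK.
by case: adj; rewrite ?mul1r ?mul0r.
Qed.

Lemma eq_gform (R : pzRingType) (G : sgraph) (p p' q q' : G -> R) :
  p =1 p' -> q =1 q' -> gform p q = gform p' q'.
Proof.
move=> pE qE; apply: eq_bigr => x _; rewrite pE /lap2 qE.
by under eq_bigr do rewrite qE.
Qed.

Lemma lap2_comb (R : comPzRingType) (G : sgraph) (p q : G -> R) (a b : R) x :
  lap2 (fun y => a * p y + b * q y) x = a * lap2 p x + b * lap2 q x.
Proof.
rewrite /lap2 big_split /= -!mulr_sumr; ring.
Qed.

Lemma gform_combr (R : comPzRingType) (G : sgraph) (r p q : G -> R) (a b : R) :
  gform r (fun y => a * p y + b * q y) = a * gform r p + b * gform r q.
Proof.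
rewrite /gform !mulr_sumr -big_split; apply: eq_bigr => x _ /=.
rewrite lap2_comb; ring.
Qed.

Lemma gform_sym (R : comPzRingType) (G : sgraph) (p q : G -> R) :
  gform p q = gform q p.
Proof.
rewrite /gform /lap2.
under eq_bigr do rewrite mulrBr; under [RHS]eq_bigr do rewrite mulrBr.
rewrite !big_split /=; congr (_ + _); first by apply: eq_bigr => x _; ring.
rewrite !sumrN; congr (- _).
under eq_bigr do rewrite big_mkcond mulr_sumr.
under [RHS]eq_bigr do rewrite big_mkcond mulr_sumr.
rewrite exchange_big; apply: eq_bigr => x _; apply: eq_bigr => y _ /=.
by rewrite adj_sym; case: adj; rewrite ?mulr0 // mulrC.
Qed.

Lemma gform_quad (R : comPzRingType) (G : sgraph) (p q : G -> R) (a b : R) :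
  gform (fun y => a * p y + b * q y) (fun y => a * p y + b * q y) =
  a ^+ 2 * gform p p + 2 * a * b * gform p q + b ^+ 2 * gform q q.
Proof.
rewrite gform_combr gform_sym gform_combr [in X in _ + X]gform_sym gform_combr.
rewrite (gform_sym q p); ring.
Qed.

Lemma gform_intr (R : comPzRingType) (G : sgraph) (p q : G -> int) :
  gform (fun x => (p x)%:~R) (fun x => (q x)%:~R) = (gform p q)%:~R :> R.
Proof.
rewrite /gform rmorph_sum; apply: eq_bigr => x _ /=.
by rewrite rmorphM /lap2 rmorphB rmorphM rmorphB !rmorph_nat rmorph_sum.
Qed.

(** A binary form with nonpositive diagonal and nonnegative determinant is
nonpositive: multiplied by a < 0 it is a sum of squares. *)
Lemma quad_nonpos (R : realDomainType) (a b c x y : R) :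
  a <= 0 -> b <= 0 -> c ^+ 2 <= a * b ->
  x ^+ 2 * a + 2 * x * y * c + y ^+ 2 * b <= 0.
Proof.
move=> a0 b0 cab; have [aE|an] := eqVneq a 0.
  have : c ^+ 2 == 0 by rewrite eq_le sqr_ge0 andbT -(mul0r b) -aE.
  rewrite sqrf_eq0 => /eqP->; rewrite aE !mulr0 !add0r mulr_ge0_le0 ?sqr_ge0 //.
have al : a < 0 by rewrite lt_neqAle an.
rewrite -(nmulr_rge0 _ al).
have -> : a * (x ^+ 2 * a + 2 * x * y * c + y ^+ 2 * b) =
  (a * x + c * y) ^+ 2 + (a * b - c ^+ 2) * y ^+ 2 by ring.
by rewrite addr_ge0 ?sqr_ge0 // mulr_ge0 ?sqr_ge0 // subr_ge0.
Qed.

(** What [2 < a(G)] gives about two vectors.  The points x and y make p and q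
linearly independent.  Integer vectors suffice for all uses below and leave the
real closed field out of the combinatorics. *)
Definition gap2 (G : sgraph) : Prop := forall p q : G -> int,
  (exists2 x, p x != 0 & q x = 0) -> (exists2 y, q y != 0 & p y = 0) ->
  gform p p <= 0 -> gform q q <= 0 -> gform p p * gform q q < gform p q ^+ 2.

Lemma connectivity_gap2 (R : rcfType) (G : sgraph) :
  2 < algebraic_connectivity R G -> gap2 G.
Proof.
move=> a2 p q [x px qx] [y qy py] pp qq; rewrite ltNge; apply/negP => pq.
move: a2; rewrite ltNge => /negP; apply.
pose row (r : G -> int) : 'rV[R]_#|G| := \row_i (r (enum_val i))%:~R.
apply: (@second_eigenvalue_le _ _ _ _ (row p) (row q)).
- exact: laplacian_sym.
- move=> a b /rowP E.
  have := E (enum_rank x); rewrite !mxE enum_rankK qx mulr0 addr0 => /eqP.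
  rewrite mulf_eq0 intr_eq0 (negPf px) orbF => /eqP ->.
  have := E (enum_rank y); rewrite !mxE enum_rankK py mulr0 add0r => /eqP.
  by rewrite mulf_eq0 intr_eq0 (negPf qy) orbF => /eqP ->.
move=> a b; rewrite /mxform laplacian_form.
rewrite (@eq_gform _ _ _ (fun z => a * (p z)%:~R + b * (q z)%:~R) _
  (fun z => a * (p z)%:~R + b * (q z)%:~R)) => [|z|z];
  try by rewrite !mxE enum_rankK.
rewrite gform_quad !gform_intr quad_nonpos ?lerz0 //.
by rewrite -rmorphXn -rmorphM /= ler_int.
Qed.

(** * Cuts and indicator vectors *)

Definition degin (G : sgraph) (x : G) (A : {set G}) : nat :=
  #|[set y in A | adj x y]|.

Lemma deginT (G : sgraph) (x : G) : degin x setT = degree x.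
Proof. by apply: eq_card => y; rewrite !inE. Qed.

Lemma degin_sum (G : sgraph) (x : G) (A : {set G}) :
  degin x A = (\sum_(y in A) adj x y)%N.
Proof.
rewrite /degin -sum1_card big_mkcond [RHS]big_mkcond.
by apply: eq_bigr => y _; rewrite inE; case: (y \in A).
Qed.

Lemma degin_exchange (G : sgraph) (A B : {set G}) :
  (\sum_(x in A) degin x B = \sum_(y in B) degin y A)%N.
Proof.
under eq_bigr do rewrite degin_sum; under [RHS]eq_bigr do rewrite degin_sum.
by rewrite exchange_big; under eq_bigr do under eq_bigr do rewrite adj_sym.
Qed.

Lemma degin_setC (G : sgraph) (x : G) (A : {set G}) :
  degree x = (degin x A + degin x (~: A))%N.
Proof.
rewrite -deginT !degin_sum (bigID (mem A)) /=.
by congr (_ + _)%N; apply: eq_bigl => y; rewrite !inE.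
Qed.

Lemma degin_le (G : sgraph) (x : G) (A : {set G}) : (degin x A <= #|A|)%N.
Proof. by apply/subset_leq_card/subsetP => y; rewrite inE => /andP[]. Qed.

Lemma degree_edges (G : sgraph) (x : G) :
  degree x = #|[set e in edges G | x \in e]|.
Proof.
have <- : [set [set x; y] | y in [set y | adj x y]] = [set e in edges G | x \in e].
  apply/setP => e; rewrite !inE; apply/imsetP/andP => [[y]|[/imset2P[a b _]]].
    rewrite inE => xy ->; rewrite !inE eqxx; split => //.
    by apply/imset2P; exists x y; rewrite ?inE.
  rewrite inE /= => ab ->; rewrite !inE => /orP[]/eqP->.
    by exists b; rewrite ?inE.
  by exists a; rewrite ?inE 1?adj_sym // setUC.
rewrite card_in_imset // => y z; rewrite !inE => xy xz /setP/(_ y).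
rewrite !inE eqxx orbT => /esym/orP[/eqP yx|/eqP//].
by rewrite yx adj_irrefl in xy.
Qed.

(** Both sides count the incidences between vertices and edges. *)
Lemma handshake (G : sgraph) : (\sum_(x : G) degree x = 2 * #|edges G|)%N.
Proof.
under eq_bigr do rewrite degree_edges -sum1dep_card.
rewrite (exchange_big_dep (mem (edges G))) /=; last by move=> ? ? _ /andP[].
rewrite mulnC -sum_nat_const; apply: eq_bigr => e /imset2P[x y _].
rewrite inE /= => xy ->.
have -> : 2%N = #|[set x; y]|.
  by rewrite cards2; case: eqP xy => // ->; rewrite adj_irrefl.
rewrite -sum1_card; apply: eq_bigl => z.
suff -> : [set x; y] \in edges G by [].
by apply/imset2P; exists x y; rewrite ?inE.
Qed.

Definition indic (G : sgraph) (S : {set G}) (x : G) : int := (x \in S)%:R.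

Lemma lap2_indic (G : sgraph) (S : {set G}) (x : G) :
  lap2 (indic S) x = ((degree x)%:R - 2) * (x \in S)%:R - (degin x S)%:R.
Proof.
rewrite /lap2 degin_sum natr_sum /=; congr (_ - _).
rewrite [LHS]big_mkcond [RHS]big_mkcond; apply: eq_bigr => y _.
by rewrite /indic; case: adj; case: (y \in S).
Qed.

Lemma gform_indic (G : sgraph) (S : {set G}) :
  gform (indic S) (indic S) =
  (\sum_(x in S) degin x (~: S))%:R - 2 * #|S|%:R.
Proof.
rewrite /gform -sum1_card !natr_sum mulr_sumr -sumrB [RHS]big_mkcond.
apply: eq_bigr => x _ /=; rewrite lap2_indic /indic.
case: (x \in S); rewrite ?mul0r // (degin_setC x S) natrD. rewrite mulr1n; ring.
Qed.

Lemma gform_indic0 (G : sgraph) (S T : {set G}) :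
  [disjoint S & T] -> (forall x y, x \in S -> y \in T -> ~~ adj x y) ->
  gform (indic S) (indic T) = 0.
Proof.
move=> dST nST; rewrite /gform big1 // => x _; rewrite lap2_indic /indic.
have [xS|] := boolP (x \in S); last by rewrite mul0r.
rewrite (disjointFr dST xS) mulr0 mul1r degin_sum big1 ?subrr // => y yT.
by rewrite (negPf (nST _ _ xS yT)).
Qed.

Definition boundary (G : sgraph) (S : {set G}) : {set G} :=
  [set y in ~: S | [exists x in S, adj x y]].

(** The vertices at distance at least two from [S]. *)
Definition outside (G : sgraph) (S : {set G}) : {set G} :=
  ~: (S :|: boundary S).

Lemma outside_nadj (G : sgraph) (S : {set G}) x y :
  x \in S -> y \in outside S -> adj x y = false.
Proof.
move=> xS; rewrite !inE => /norP[yS /nandP[/negPn|]]; first by rewrite (negPf yS).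
by move/exists_inPn/(_ x xS)/negPf.
Qed.

Lemma degin_boundary (G : sgraph) (S : {set G}) x :
  x \in S -> degin x (~: S) = degin x (boundary S).
Proof.
move=> xS; apply: eq_card => y; rewrite !inE.
case: (y \in S) => //=; case xy: (adj x y); rewrite ?andbF ?andbT //=.
by apply/esym/exists_inP; exists x.
Qed.

Lemma degin_outside (G : sgraph) (S : {set G}) y :
  y \in outside S -> degin y (~: outside S) = degin y (boundary S).
Proof.
move=> yT; apply: eq_card => x; rewrite !inE.
case: (boolP (x \in S)) => //= xS; last by rewrite negbK.
by rewrite adj_sym (outside_nadj xS yT).
Qed.

(** The indicators of S and of [outside S] are Q-orthogonal, and the value of Q at
the indicator of a set is the size of its edge cut minus twice its cardinal.  So
they cannot both have at most two cut edges per vertex. *)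
Lemma gap2_outside (G : sgraph) (S : {set G}) :
  gap2 G -> S != set0 -> outside S != set0 ->
  (\sum_(x in S) degin x (boundary S) <= 2 * #|S|)%N ->
  (2 * #|outside S| < \sum_(y in boundary S) degin y (outside S))%N.
Proof.
move=> gap /set0Pn[x xS] /set0Pn[y yT].
set T := outside S; set N := boundary S; move=> cS.
have dST : [disjoint S & T].
  by rewrite -subsets_disjoint subsetUl.
have := gap (indic S) (indic T).
have -> : gform (indic S) (indic T) = 0.
  by apply: gform_indic0 => // a b aS bT; rewrite (outside_nadj aS bT).
rewrite !gform_indic expr0n /=.
rewrite (eq_bigr _ (fun x (h : x \in S) => degin_boundary h)).
rewrite (eq_bigr _ (fun x (h : x \in T) => degin_outside h)) -/N.
rewrite (degin_exchange T N) ltnNge => H; apply/negP => cT.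
move: H; set a := (X in X * _ < _); set b := (X in _ * X < _).
have a0 : a <= 0 by rewrite /a; lia.
have b0 : b <= 0 by rewrite /b; lia.
suff: ~~ (a * b < 0).
  move/negP => nlt H; apply: nlt; apply: H => //.
    by exists x; rewrite /indic ?xS // (disjointFr dST xS).
  by exists y; rewrite /indic ?yT // (disjointFl dST yT).
by rewrite -leNgt mulr_le0.
Qed.

(** * Minimum degree, and independence of the cubic vertices *)

Lemma card_outside (G : sgraph) (S : {set G}) :
  (#|S| + #|boundary S| + #|outside S| = #|G|)%N.
Proof.
have d : [disjoint S & boundary S].
  by rewrite disjoints_subset; apply/subsetP => x xS; rewrite !inE xS.
have -> : (#|S| + #|boundary S|)%N = #|S :|: boundary S|.
  by rewrite cardsU (disjoint_setI0 d) cards0 subn0.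
by rewrite cardsC.
Qed.

Lemma boundary_le (G : sgraph) (S : {set G}) :
  (#|boundary S| <= \sum_(x in S) degin x (boundary S))%N.
Proof.
rewrite degin_exchange -sum1_card; apply: leq_sum => y.
rewrite !inE => /andP[_ /exists_inP[x xS xy]].
by apply/card_gt0P; exists x; rewrite inE xS adj_sym.
Qed.

(** With S a single vertex of degree at most 2, each vertex outside has at most two
neighbours in the boundary, so both cuts are sparse. *)
Lemma gap2_min_degree (G : sgraph) (v : G) :
  gap2 G -> (3 < #|G|)%N -> (2 < degree v)%N.
Proof.
move=> gap n4; rewrite ltnNge; apply/negP => dv.
have bE : (\sum_(x in [set v]) degin x (boundary [set v]) <= degree v)%N.
  by rewrite big_set1 (degin_setC v (boundary [set v])) leq_addr.
have nb := leq_trans (boundary_le _) bE.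
have := card_outside [set v]; rewrite cards1 => cT.
have /(_ gap) := @gap2_outside G [set v].
rewrite -!card_gt0 cards1 (leq_trans bE) // => /(_ isT).
have -> : (0 < #|outside [set v]|)%N by lia.
move/(_ isT isT).
rewrite -degin_exchange ltnNge => /negP; apply.
rewrite mulnC -sum_nat_const; apply: leq_sum => x _.
exact: leq_trans (degin_le _ _) (leq_trans nb dv).
Qed.

(** The degrees in the boundary are bounded below by the edges going to S and to the
outside. *)
Lemma sum_boundary (G : sgraph) (S : {set G}) :
  (\sum_(x : G) degree x >= \sum_(x in S) degree x + \sum_(x in S) degin x (boundary S) +
   \sum_(y in boundary S) degin y (outside S) + \sum_(y in outside S) degree y)%N.
Proof.
have -> : (\sum_(x : G) degree x = \sum_(x in S) degree x +
    \sum_(x in boundary S) degree x + \sum_(x in outside S) degree x)%N.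
  rewrite -[RHS]addnA (bigID (mem S)) /=; congr (_ + _)%N.
  rewrite (bigID (mem (boundary S))) /=; congr (_ + _)%N; apply: eq_bigl => x.
    by rewrite !inE; case: (x \in S).
  by rewrite !inE negb_or.
rewrite leq_add2r -addnA leq_add2l degin_exchange -big_split leq_sum // => y _ /=.
rewrite (degin_setC y S) leq_add2l.
apply/subset_leq_card/subsetP => x; rewrite !inE negb_or.
by case/andP => /andP[-> _] ->.
Qed.

(** An edge between cubic vertices is a set with four cut edges and a boundary of at
most four vertices.  The cut of its outside T must then exceed [2 #|T|]; together
with degree at least 3 inside T this gives a degree sum of at least
[6 + 4 + (2 #|T| + 1) + 3 #|T|], which is more than [4 n - 8] as soon as n is at
least 12. *)
Lemma gap2_cubic_independent (G : sgraph) (v w : G) :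
  gap2 G -> (12 <= #|G|)%N -> #|edges G| = (2 * #|G| - 4)%N ->
  degree v = 3%N -> degree w = 3%N -> ~~ adj v w.
Proof.
move=> gap n12 mE dv dw; apply/negP => vw.
pose S := [set v; w].
have nvw : v != w by apply: contraTneq vw => ->; rewrite adj_irrefl.
have cS : #|S| = 2%N by rewrite cards2 nvw.
have cut x y : x != y -> adj x y -> (degin x (boundary [set x; y]) = degree x - 1)%N.
  move=> xy axy; rewrite -degin_boundary ?inE ?eqxx // (degin_setC x [set x; y]).
  suff -> : degin x [set x; y] = 1%N by rewrite addKn.
  by rewrite degin_sum big_setU1 ?inE //= big_set1 adj_irrefl axy.
have cutS : (\sum_(x in S) degin x (boundary S) = 4)%N.
  rewrite big_setU1 ?inE //= big_set1 cut // dv /S setUC cut ?dw 1?eq_sym //.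
  by rewrite adj_sym.
have kS : (#|boundary S| <= 4)%N by rewrite -cutS boundary_le.
have := card_outside S; rewrite cS => cT.
have := gap2_outside (S := S) gap; rewrite -!card_gt0 cS cutS => /(_ isT).
have -> : (0 < #|outside S|)%N by lia.
move/(_ isT isT) => gT.
have dT : (3 * #|outside S| <= \sum_(y in outside S) degree y)%N.
  rewrite mulnC -sum_nat_const; apply: leq_sum => y _.
  by apply: gap2_min_degree => //; lia.
have := sum_boundary S; rewrite handshake mE cutS.
have -> : (\sum_(x in S) degree x = 6)%N.
  by rewrite big_setU1 ?inE //= big_set1 dv dw.
lia.
Qed.

(** * Stars: eliminating the cubic vertices *)

Definition cubic (G : sgraph) : {set G} := [set x | degree x == 3].

(** If no two cubic vertices are adjacent and the values at the other vertices are
given, then Q is minimized by giving each cubic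
vertex the sum of the values of its neighbours; [star u] is this extension of
the coordinate vector of u. *)
Definition star (G : sgraph) (u x : G) : int :=
  (x == u)%:R + ((x \in cubic G) && adj x u)%:R.

Definition link (G : sgraph) (u w : G) : nat :=
  adj u w + #|[set x in cubic G | adj u x && adj x w]|.

Definition cubic_independent (G : sgraph) : Prop :=
  forall x y : G, x \in cubic G -> y \in cubic G -> adj x y = false.

Lemma sum_star (G : sgraph) (u w : G) :
  \sum_(y | adj u y) star w y = (link u w)%:R.
Proof.
rewrite /star big_split /= /link natrD; congr (_ + _).
  rewrite big_mkcond (bigD1 w) //= eqxx big1 => [|y /negPf->]; last by case: ifP.
  by rewrite addr0; case: adj.
rewrite -sum1dep_card natr_sum big_mkcond [RHS]big_mkcond.
apply: eq_bigr => y _ /=.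
by case: (adj u y); case: (y \in _); case: (adj y w).
Qed.

(** At a cubic x adjacent to w, the diagonal term [(3 - 2) * 1] cancels the value 1 of
the neighbour w; so stars are orthogonal to the coordinate vectors of cubic
vertices. *)
Lemma lap2_star_cubic (G : sgraph) (w x : G) : cubic_independent G ->
  w \notin cubic G -> x \in cubic G -> lap2 (star w) x = 0.
Proof.
move=> ind wB xC; rewrite /lap2 sum_star /star /link xC.
have -> : [set y in cubic G | adj x y && adj y w] = set0.
  apply/setP => y; rewrite in_set [in RHS]inE; apply/negbTE/negP.
  by case/and3P => yC xy _; rewrite (ind x y) in xy.
have -> : (x == w) = false by apply/eqP => xw; rewrite -xw xC in wB.
move: xC; rewrite inE => /eqP->; rewrite cards0 addn0 /=; ring.
Qed.

Lemma lap2_star (G : sgraph) (u w : G) :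
  u \notin cubic G -> w \notin cubic G ->
  lap2 (star w) u = ((degree u)%:R - 2) * (u == w)%:R - (link u w)%:R.
Proof. by move=> uB wB; rewrite /lap2 sum_star /star (negPf uB) mulr0n addr0. Qed.

Lemma gform_star (G : sgraph) (u w : G) : cubic_independent G ->
  u \notin cubic G -> w \notin cubic G ->
  gform (star u) (star w) = ((degree u)%:R - 2) * (u == w)%:R - (link u w)%:R.
Proof.
move=> ind uB wB; rewrite -lap2_star // /gform (bigD1 u) //= big1 => [|x xu].
  have -> : star u u = 1 by rewrite /star eqxx (negPf uB).
  by rewrite mul1r addr0.
have [xC|xB] := boolP (x \in cubic G); first by rewrite lap2_star_cubic ?mulr0.
by rewrite [star u x]/star (negPf xu) (negPf xB) mul0r.
Qed.

Lemma link_self (G : sgraph) (u : G) : link u u = degin u (cubic G).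
Proof.
rewrite /link adj_irrefl; apply: eq_card => x.
by rewrite !inE (adj_sym x u) andbb.
Qed.

Definition ncdeg (G : sgraph) (u : G) : nat := degin u (~: cubic G).

Lemma gform_star_self (G : sgraph) (u : G) : cubic_independent G ->
  u \notin cubic G -> gform (star u) (star u) = (ncdeg u)%:R - 2.
Proof.
move=> ind uB; rewrite gform_star // eqxx link_self (degin_setC u (cubic G)).
rewrite natrD /ncdeg /=; ring.
Qed.

Lemma gap2_link (G : sgraph) (u w : G) : gap2 G -> cubic_independent G ->
  u \notin cubic G -> w \notin cubic G -> u != w ->
  (ncdeg u <= 2)%N -> (ncdeg w <= 2)%N ->
  ((2 - ncdeg u) * (2 - ncdeg w) < link u w ^ 2)%N.
Proof.
move=> gap ind uB wB uw u2 w2.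
have := gap (star u) (star w); rewrite !gform_star_self // gform_star //.
rewrite (negPf uw) mulr0 sub0r sqrrN => H.
have /H : exists2 x, star u x != 0 & star w x = 0.
  by exists u; rewrite /star ?eqxx ?(negPf uB) ?(negPf uw).
have H2 : exists2 y, star w y != 0 & star u y = 0.
  by exists w; rewrite /star ?eqxx ?(negPf wB) // eq_sym (negPf uw).
move/(_ H2); move: u2 w2 => {H H2}.
move: (ncdeg u) (ncdeg w) (link u w) => a b c; nia.
Qed.

(** Applied with [a = b], or with two [single] vertices, this says that two
nonpositive sums of stars at distinct vertices must be linked: if they were
orthogonal, Q would be nonpositive on the plane that they span. *)
Lemma gap2_pairs (G : sgraph) (a b c d : G) : gap2 G -> cubic_independent G ->
  [/\ a \notin cubic G, b \notin cubic G, c \notin cubic G & d \notin cubic G] ->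
  a != c -> a != d -> b != c ->
  gform (star a) (star a) + 2 * gform (star a) (star b) + gform (star b) (star b) <= 0 ->
  gform (star c) (star c) + 2 * gform (star c) (star d) + gform (star d) (star d) <= 0 ->
  b != d ->
  (0 < link a c + link a d + link b c + link b d)%N.
Proof.
move=> gap ind [aB bB cB dB] ac ad bc pa pc bd; rewrite lt0n; apply/negP => /eqP l0.
pose p x : int := 1 * star a x + 1 * star b x.
pose q x : int := 1 * star c x + 1 * star d x.
have ppE : gform p p <= 0.
  by rewrite gform_quad; move: pa; rewrite !expr1n !mulr1 !mul1r.
have qqE : gform q q <= 0.
  by rewrite gform_quad; move: pc; rewrite !expr1n !mulr1 !mul1r.
have pqE : gform p q = 0.
  rewrite gform_combr ![gform p _]gform_sym !gform_combr ![gform (star c) _]gform_sym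
     ![gform (star d) _]gform_sym !gform_star //.
  rewrite (negPf ac) (negPf ad) (negPf bc) (negPf bd) /=.
  have [-> -> -> ->] : [/\ link a c = 0, link a d = 0, link b c = 0 & link b d = 0]%N.
    by split; lia.
  by rewrite mulr0n !(mulr0, subr0, addr0).
have := gap p q; rewrite pqE expr0n /= => H.
suff: ~~ (gform p p * gform q q < 0).
  move/negP; apply; apply: H => //.
    exists a; rewrite /p /q /star ?eqxx (negPf aB) ?(negPf ac) ?(negPf ad) //=.
    by case: (a == b).
  exists c; rewrite /p /q /star ?eqxx (negPf cB) ?(eq_sym c) ?(negPf ac) ?(negPf bc) //=.
  by case: (d == c).
by rewrite -leNgt mulr_le0.
Qed.

(** * Counting low, single and busy vertices *)

(** The vertices whose star has a nonpositive form. *)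
Definition low (G : sgraph) : {set G} := [set u in ~: cubic G | (ncdeg u <= 2)%N].

(** These vertices have degree 4.  They are the vertices that are not low and still
contribute 1 to the surplus in [deficiency]. *)
Definition single (G : sgraph) : {set G} :=
  [set u in ~: cubic G | (ncdeg u == 3%N) && (degin u (cubic G) == 1%N)].

Definition busy (G : sgraph) : {set G} :=
  [set v in cubic G | (1 < degin v (single G))%N].

Lemma card_setIdE (T : finType) (A : {set T}) (P : pred T) :
  #|[set x in A | P x]| = (\sum_(x in A) P x)%N.
Proof.
rewrite -sum1_card big_mkcond [RHS]big_mkcond.
by apply: eq_bigr => x _; rewrite inE; case: (x \in A).
Qed.

Lemma degin_disjoint (G : sgraph) (x : G) (A B D : {set G}) :
  A \subset D -> B \subset D -> [disjoint A & B] ->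
  (degin x A + degin x B <= degin x D)%N.
Proof.
move=> AD BD dis; rewrite /degin -cardsUI.
have -> : #|[set y in A | adj x y] :&: [set y in B | adj x y]| = 0%N.
  apply/eqP; rewrite cards_eq0; apply/eqP/setP => y.
  rewrite !inE; case: (boolP (y \in A)) => //= yA.
  by rewrite (disjointFr dis yA) andbF.
rewrite addn0; apply/subset_leq_card/subsetP => y.
rewrite !inE => /orP[] /andP[h ->]; rewrite andbT; last exact: (subsetP BD).
exact: (subsetP AD).
Qed.

Section Counting.

Local Open Scope nat_scope.

Variable G : sgraph.
Hypothesis gap : gap2 G.
Hypothesis n12 : 12 <= #|G|.
Hypothesis mE : #|edges G| = 2 * #|G| - 4.

Local Notation C := (cubic G).
Local Notation U := (low G).
Local Notation F := (single G).
Local Notation V := (busy G).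

Lemma degree_ge3 (v : G) : 2 < degree v.
Proof. by apply: gap2_min_degree => //; apply: leq_trans n12. Qed.

Lemma cubic_indep : cubic_independent G.
Proof.
move=> x y; rewrite !inE => /eqP dx /eqP dy.
by apply/negbTE/gap2_cubic_independent.
Qed.

Lemma degree_split (u : G) : degree u = degin u C + ncdeg u.
Proof. exact: degin_setC. Qed.

Lemma degin_cubic (v : G) : v \in C -> degin v (~: C) = 3.
Proof.
move=> vC; have := degree_split v; rewrite /ncdeg.
have -> : degin v C = 0.
  by rewrite degin_sum big1 // => y yC; rewrite cubic_indep.
rewrite add0n => <-; by apply/eqP; rewrite inE in vC.
Qed.

Lemma noncubic_degree (u : G) : u \in ~: C -> 4 <= degin u C + ncdeg u.
Proof.
rewrite !inE => du; have := degree_ge3 u; rewrite -degree_split; lia.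
Qed.

Lemma sum_cubic_degin : \sum_(u in ~: C) degin u C = 3 * #|C|.
Proof.
rewrite degin_exchange mulnC -sum_nat_const; apply: eq_bigr => v.
exact: degin_cubic.
Qed.

(** This is the edge count, rewritten in terms of the noncubic vertices alone: the
degree sum is [4 n - 8], and the edges leaving the cubic vertices number
[3 #|C|]. *)
Lemma sum_noncubic :
  8 * #|~: C| = \sum_(u in ~: C) (2 * ncdeg u + degin u C) + 16 + #|C|.
Proof.
have := handshake G; rewrite mE (bigID (mem C)) /= => E.
have E1 : \sum_(v in C) degree v = 3 * #|C|.
  by rewrite mulnC -sum_nat_const; apply: eq_bigr => v; rewrite inE => /eqP.
have E2 : \sum_(v | v \notin C) degree v = \sum_(u in ~: C) (degin u C + ncdeg u).
  by apply: eq_big => u; rewrite ?inE // degree_split.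
have E3 : \sum_(u in ~: C) (degin u C + ncdeg u) =
  \sum_(u in ~: C) degin u C + \sum_(u in ~: C) ncdeg u by rewrite big_split.
have E4 : \sum_(u in ~: C) (2 * ncdeg u + degin u C) =
  2 * \sum_(u in ~: C) ncdeg u + \sum_(u in ~: C) degin u C.
  by rewrite big_split big_distrr.
rewrite E4; move: E; rewrite E1 E2 E3 sum_cubic_degin.
by move: n12; rewrite -(cardsC C); lia.
Qed.

Lemma low_single_disjoint : [disjoint U & F].
Proof.
rewrite disjoints_subset; apply/subsetP => u; rewrite !inE.
by case/andP=> -> b; case: (ncdeg u =P 3) => // b3; rewrite b3 in b.
Qed.

(** Outside [low], [8 - 2 beta - t] is at most 1, and equals 1 only if [beta = 3]
and [t = 1], because [beta + t] is at least 4. *)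
Lemma deficiency :
  16 + #|C| + \sum_(u in U) (2 * ncdeg u + degin u C) <= 8 * #|U| + #|F|.
Proof.
have := sum_noncubic.
have UB : U \subset ~: C by apply/subsetP => u; rewrite [u \in U]inE => /andP[].
have FB : F \subset ~: C by apply/subsetP => u; rewrite [u \in F]inE => /andP[].
have h : 8 * #|~: C :\: U| <=
    \sum_(u in ~: C :\: U) (2 * ncdeg u + degin u C) + #|F|.
  have -> : #|F| = \sum_(u in ~: C :\: U) (u \in F).
    rewrite -sum1_card -big_mkcondr; apply: eq_bigl => u.
    rewrite [in RHS]in_setD andbC; have [uF|] //= := boolP (u \in F).
    by rewrite (disjointFl low_single_disjoint uF) (subsetP FB).
  rewrite mulnC -sum_nat_const -big_split; apply: leq_sum => u.
  rewrite in_setD [u \in U]inE => /andP[nU uB].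
  rewrite [u \in F]inE uB /=; rewrite uB /= in nU.
  by have := noncubic_degree uB; case: eqP; case: eqP => /=; lia.
rewrite (big_setID U) /= (setIidPr UB) -(cardsID U (~: C)) (setIidPr UB).
lia.
Qed.

Lemma single_unique (f v w : G) : f \in F -> v \in C -> w \in C ->
  adj f v -> adj f w -> v = w.
Proof.
rewrite [f \in F]inE => /andP[_ /andP[_ /cards1P[x xE]]] vC wC fv fw.
have : v \in [set x] by rewrite -xE inE vC.
have : w \in [set x] by rewrite -xE inE wC.
by rewrite !inE => /eqP-> /eqP->.
Qed.

Lemma sum_single : \sum_(v in C) degin v F = #|F|.
Proof.
rewrite degin_exchange -sum1_card; apply: eq_bigr => f.
by rewrite [f \in F]inE => /andP[_ /andP[_ /eqP]].
Qed.

Lemma single_sub : F \subset ~: C.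
Proof. by apply/subsetP => u; rewrite [u \in F]inE => /andP[]. Qed.

Lemma low_sub : U \subset ~: C.
Proof. by apply/subsetP => u; rewrite [u \in U]inE => /andP[]. Qed.

(** The single and the low neighbours of v are distinct, and there are at most three
of them in all. *)
Lemma cubic_charge (v : G) : v \in C ->
  degin v F + (degin v U == 3) <= 1 + (if v \in V then 2 - degin v U else 0).
Proof.
move=> vC; have := degin_disjoint v low_sub single_sub low_single_disjoint.
rewrite degin_cubic // [v \in V]inE vC /=.
by case: ltnP; case: eqP => /=; lia.
Qed.

Lemma deficiency_low :
  16 + \sum_(v in C) (degin v U == 3) + \sum_(u in U) (2 * ncdeg u + degin u C)
   <= 8 * #|U| + \sum_(v in V) (2 - degin v U).
Proof.
have := deficiency; rewrite -sum_single.
have : \sum_(v in C) (degin v F + (degin v U == 3)) <=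
       \sum_(v in C) (1 + (if v \in V then 2 - degin v U else 0)).
  by apply: leq_sum => v; apply: cubic_charge.
rewrite !big_split /= sum1_card.
have -> : \sum_(v in V) (2 - degin v U) =
          \sum_(v in C) (if v \in V then 2 - degin v U else 0).
  by rewrite -big_mkcondr; apply: eq_bigl => v; rewrite [v \in V]inE; case: (v \in C).
lia.
Qed.

(** A single vertex has only one cubic neighbour, so distinct cubic vertices use
distinct single vertices of N. *)
Lemma busy_image (X N : {set G}) : X \subset V ->
  (forall v, v \in X -> exists2 f, f \in F :&: N & adj v f) -> #|X| <= #|F :&: N|.
Proof.
move=> XV H.
pose h (f : G) := odflt f [pick v in C | adj f v].
apply: leq_trans (leq_imset_card h _).
apply/subset_leq_card/subsetP => v vX; have [f fN vf] := H v vX.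
apply/imsetP; exists f => //; rewrite /h; case: pickP => [w /andP[wC fw]|/(_ v)].
  have := subsetP XV v vX; rewrite inE => /andP[vC _].
  by apply: single_unique vC wC _ fw; [case/setIP: fN | rewrite adj_sym].
have := subsetP XV v vX; rewrite inE => /andP[-> _].
by rewrite adj_sym vf.
Qed.

Lemma single_pair (v f g : G) : v \in C -> f \in F -> g \in F -> f != g ->
  adj v f -> adj v g ->
  (gform (star f) (star f) + 2 * gform (star f) (star g) + gform (star g) (star g) <= 0 :> int)%R.
Proof.
move=> vC fF gF fg vf vg; have ind := cubic_indep.
have fB := subsetP single_sub f fF; have gB := subsetP single_sub g gF.
rewrite inE in fB; rewrite inE in gB.
rewrite !gform_star_self // gform_star // (negPf fg).
move: fF gF; rewrite [f \in F]inE [g \in F]inE.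
case/andP=> _ /andP[/eqP-> _] /andP[_ /andP[/eqP-> _]].
suff : 0 < link f g by case: link => // k _; lia.
rewrite addn_gt0; apply/orP; right; apply/card_gt0P; exists v.
by rewrite inE vC adj_sym vf vg.
Qed.

(** Every walk of length 2 that ends at f and passes through a cubic vertex passes
through v. *)
Lemma link_single (w v f : G) : f \in F -> v \in C -> adj v f -> ~~ adj v w ->
  link w f = adj w f.
Proof.
move=> fF vC vf vw; rewrite /link; set X := [set x in _ | _].
suff -> : X = set0 by rewrite cards0 addn0.
apply/setP => x; rewrite in_set [in RHS]inE; apply/negbTE/negP.
case/and3P => xC wx xf; move: vw; rewrite (single_unique fF vC xC) 1?adj_sym //.
  by rewrite wx.
Qed.

Lemma busyP (v : G) : v \in V -> v \in C /\
  exists f g, [/\ f \in F, g \in F, f != g, adj v f & adj v g].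
Proof.
rewrite [v \in V]inE => /andP[vC /card_gt1P[f [g []]]].
rewrite in_set => /andP[fF vf]; rewrite in_set => /andP[gF vg] fg; split=> //.
by exists f, g.
Qed.

(** Otherwise [star w] and the sum of the stars of two single neighbours of v would
be orthogonal. *)
Lemma low_touch (w v : G) : w \in U -> v \in V -> ~~ adj v w ->
  exists2 f, f \in F :&: [set f | adj w f] & adj v f.
Proof.
move=> wU /busyP[vC [f [g [fF gF fg vf vg]]]] vw.
have ind := cubic_indep.
have wB := subsetP low_sub w wU; rewrite inE in wB.
have fB := subsetP single_sub f fF; have gB := subsetP single_sub g gF.
rewrite inE in fB; rewrite inE in gB.
have wf x : x \in F -> w != x.
  by move=> xF; apply: contraTneq xF => <-; rewrite (disjointFr low_single_disjoint wU).
have := @gap2_pairs G w w f g gap ind.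
rewrite !wf // (link_single fF vC vf vw) (link_single gF vC vg vw) => H.
have : 0 < adj w f + adj w g + adj w f + adj w g.
  apply: H => //; last exact: (single_pair vC).
  rewrite gform_star_self //; move: wU; rewrite inE => /andP[_]; lia.
case wf' : (adj w f); first by exists f; rewrite // in_setI fF in_set.
case wg' : (adj w g) => //; by exists g; rewrite // in_setI gF in_set.
Qed.

Lemma busy_touch (v v' f g f' g' : G) : v \in C -> v' \in C -> v != v' ->
  [/\ f \in F, g \in F, f != g, adj v f & adj v g] ->
  [/\ f' \in F, g' \in F, f' != g', adj v' f' & adj v' g'] ->
  0 < adj f f' + adj f g' + adj g f' + adj g g'.
Proof.
move=> vC vC' vv' [fF gF fg vf vg] [fF' gF' fg' vf' vg'].
have ind := cubic_indep.
have nC x : x \in F -> x \notin C.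
  by move=> xF; have := subsetP single_sub x xF; rewrite inE.
have nv x : x \in F -> adj v x -> ~~ adj v' x.
  move=> xF vx; apply: contraNN vv' => vx'.
  by apply/eqP; apply: (single_unique xF) => //; rewrite adj_sym.
have ne x y : x \in F -> adj v x -> adj v' y -> x != y.
  by move=> xF vx vy; apply: contraTneq vy => <-; apply: nv.
rewrite -!(link_single fF' vC' vf') ?nv // -!(link_single gF' vC' vg') ?nv //.
apply: (@gap2_pairs G) => //; rewrite ?ne //.
- by split; apply: nC.
- exact: (single_pair vC).
exact: (single_pair vC').
Qed.

(** Fix a busy v with single neighbours f and g.  Every other busy vertex owns a
single neighbour of f or of g, and f and g have at most three each. *)
Lemma card_busy : #|V| <= 7.
Proof.
have [->|[v vV]] := set_0Vmem V; first by rewrite cards0.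
have [vC [f [g H]]] := busyP vV.
pose N := [set x | adj f x || adj g x].
have : #|V :\ v| <= #|F :&: N|.
  apply: busy_image => [|v']; first exact: subD1set.
  case/setD1P => v'v /busyP[v'C [f' [g' H']]].
  have := busy_touch vC v'C _ H H'; rewrite eq_sym => /(_ v'v).
  case: H' => fF gF _ vf vg.
  have [a _|/norP[/negPf-> /negPf->]] := boolP (adj f f' || adj g f').
    by exists f' => //; rewrite in_setI fF inE.
  rewrite addn0 add0n; have [a _|/norP[/negPf-> /negPf->]//] := boolP (adj f g' || adj g g').
  by exists g' => //; rewrite in_setI gF inE.
have bF x : x \in F -> degin x F <= 3.
  rewrite [x \in F]inE => /andP[_ /andP[/eqP<- _]].
  by have := degin_disjoint x low_sub single_sub low_single_disjoint; rewrite /ncdeg; lia.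
have : #|F :&: N| <= degin f F + degin g F.
  rewrite /degin -cardsUI; apply: leq_trans (leq_addr _ _).
  apply/subset_leq_card/subsetP => x /setIP[xF]; rewrite in_set => xN.
  by rewrite in_setU in_set [in X in _ || X]in_set xF.
case: H => /bF ? /bF ? _ _ _; rewrite [#|V|](cardsD1 v) vV; lia.
Qed.

(** The two terms count disjoint sets of noncubic neighbours of w: low ones, and
single ones forced by [low_touch]. *)
Lemma low_degree (w : G) : w \in U ->
  #|[set v in V | ~~ adj v w]| + degin w U <= ncdeg w.
Proof.
move=> wU; have := degin_disjoint w low_sub single_sub low_single_disjoint.
rewrite -/(ncdeg w) addnC => /(leq_trans _); apply; rewrite leq_add2r.
have -> : degin w F = #|F :&: [set f | adj w f]|.
  by apply: eq_card => f; rewrite in_setI in_set [f \in [set f0 | _]]in_set.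
apply: busy_image => [|v]; first by apply/subsetP => v; rewrite in_set => /andP[].
by rewrite in_set => /andP[vV vw]; apply: low_touch.
Qed.

Lemma busy_degin_low (v : G) : v \in V -> degin v U <= 1.
Proof.
rewrite [v \in V]inE => /andP[vC v2].
have := degin_disjoint v low_sub single_sub low_single_disjoint.
by rewrite degin_cubic //; lia.
Qed.

(** If q <= 2, then [deficiency_low] and [card_busy] give
[16 + \sum beta <= 4 q + 7 + h], the sum being over low vertices, where h is the
number of busy vertices without a low neighbour.  Either q = 0 and h <= 7, or
h <= beta w for any low w. *)
Lemma low_size : 2 < #|U|.
Proof.
rewrite ltnNge; apply/negP => q2.
have := deficiency_low.
have hU : 4 * #|U| <= \sum_(u in U) (ncdeg u + degin u C).
  rewrite mulnC -sum_nat_const; apply: leq_sum => u uU.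
  by rewrite addnC noncubic_degree // (subsetP low_sub).
have -> : \sum_(u in U) (2 * ncdeg u + degin u C) =
    \sum_(u in U) ncdeg u + \sum_(u in U) (ncdeg u + degin u C).
  by rewrite -big_split; apply: eq_bigr => u _ /=; lia.
have hV : \sum_(v in V) (2 - degin v U) <= #|V| + #|[set v in V | degin v U == 0]|.
  rewrite card_setIdE -sum1_card -big_split; apply: leq_sum => v _ /=.
  by case: (degin v U) => [|[|]].
have V7 := card_busy.
have [U0|[w wU]] := set_0Vmem U.
  have : #|[set v in V | degin v U == 0]| <= #|V|.
    by apply/subset_leq_card/subsetP => v; rewrite in_set => /andP[].
  have -> : #|U| = 0 by rewrite U0 cards0.
  lia.
have : #|[set v in V | degin v U == 0]| <= ncdeg w.
  apply: leq_trans (low_degree wU); apply: leq_trans (leq_addr _ _).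
  apply/subset_leq_card/subsetP => v; rewrite in_set => /andP[vV v0].
  rewrite in_set vV; apply: contraTN v0 => vw; rewrite -lt0n.
  by apply/card_gt0P; exists w; rewrite in_set wU.
have : ncdeg w <= \sum_(u in U) ncdeg u by rewrite (bigD1 w) //= leq_addr.
lia.
Qed.

Lemma sum_low_degree :
  \sum_(v in V) (#|U| - degin v U) + \sum_(w in U) degin w U <= \sum_(w in U) ncdeg w.
Proof.
have -> : \sum_(v in V) (#|U| - degin v U) = \sum_(w in U) #|[set v in V | ~~ adj v w]|.
  under [RHS]eq_bigr do rewrite card_setIdE.
  rewrite exchange_big; apply: eq_bigr => v vV /=.
  rewrite -sum1_card degin_sum.
  have -> : \sum_(w in U) 1 = \sum_(w in U) adj v w + \sum_(w in U) ~~ adj v w.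
    by rewrite -big_split; apply: eq_bigr => w _; case: adj.
  by rewrite addKn.
by rewrite -big_split; apply: leq_sum => w; apply: low_degree.
Qed.

(** Counts the walks of length 1, or of length 2 through a cubic vertex, that begin
and end in low vertices. *)
Lemma sum_link :
  \sum_(w in U) \sum_(u in U) link w u =
  \sum_(w in U) degin w U + \sum_(v in C) degin v U ^ 2.
Proof.
have E (w u : G) : link w u = adj w u + \sum_(x in C) adj w x * adj x u.
  rewrite /link card_setIdE; congr (_ + _); apply: eq_bigr => x _.
  by rewrite mulnb.
have -> : \sum_(w in U) \sum_(u in U) link w u =
  \sum_(w in U) (degin w U + \sum_(x in C) adj w x * degin x U).
  apply: eq_bigr => w _; under eq_bigr do rewrite E.
  rewrite big_split /= -degin_sum; congr (_ + _).
  by rewrite exchange_big; apply: eq_bigr => x _; rewrite degin_sum big_distrr.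
rewrite big_split /= exchange_big /=; congr (_ + _).
apply: eq_bigr => x _; rewrite -big_distrl expnS expn1 degin_sum /=.
by congr (_ * _); apply: eq_bigr => w _; rewrite adj_sym.
Qed.

(** The bound [(2 - beta w) (2 - beta u) < link w u ^ 2] of [gap2_link], evaluated for
beta in 0, 1, 2. *)
Lemma link_low (w u : G) : w \in U -> u \in U -> w != u ->
  1 + (ncdeg w <= 1) * (ncdeg u <= 1) + (ncdeg w == 0) * (ncdeg u == 0) <= link w u.
Proof.
move=> wU uU wu; have := gap2_link gap cubic_indep _ _ wu.
have := subsetP low_sub w wU; rewrite in_setC => wB.
have := subsetP low_sub u uU; rewrite in_setC => uB.
move/(_ wB uB); move: wU uU; rewrite !inE => /andP[_ w2] /andP[_ u2] /(_ w2 u2).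
move: (ncdeg w) (ncdeg u) (link w u) w2 u2.
by case=> [|[|[|//]]]; case=> [|[|[|//]]]; case=> [|[|[|]]].
Qed.

Lemma sum_link_ge (P1 := [set w in U | ncdeg w <= 1]) (P0 := [set w in U | ncdeg w == 0]) :
  #|U| ^ 2 + #|P1| ^ 2 + #|P0| ^ 2 + \sum_(w in U) degin w C <=
  \sum_(w in U) \sum_(u in U) link w u + #|U| + #|P1| + #|P0|.
Proof.
have c1 : #|P1| = \sum_(w in U) (ncdeg w <= 1) by rewrite card_setIdE.
have c0 : #|P0| = \sum_(w in U) (ncdeg w == 0) by rewrite card_setIdE.
have -> : #|U| ^ 2 + #|P1| ^ 2 + #|P0| ^ 2 + \sum_(w in U) degin w C =
  \sum_(w in U) (\sum_(u in U)
    (1 + (ncdeg w <= 1) * (ncdeg u <= 1) + (ncdeg w == 0) * (ncdeg u == 0)) + degin w C).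
  rewrite big_split /=; congr (_ + _).
  have -> : \sum_(w in U) \sum_(u in U)
    (1 + (ncdeg w <= 1) * (ncdeg u <= 1) + (ncdeg w == 0) * (ncdeg u == 0)) =
    \sum_(w in U) (#|U| + (ncdeg w <= 1) * #|P1| + (ncdeg w == 0) * #|P0|).
    apply: eq_bigr => w _; rewrite !big_split /= sum1_card c1 c0.
    by rewrite -!big_distrr.
  by rewrite !big_split /= sum_nat_const -!big_distrl /= -c1 -c0 !expnS !expn0 !muln1.
have -> : \sum_(w in U) \sum_(u in U) link w u + #|U| + #|P1| + #|P0| =
  \sum_(w in U) (\sum_(u in U) link w u + 1 + (ncdeg w <= 1) + (ncdeg w == 0)).
  by rewrite !big_split /= sum1_card c1 c0.
apply: leq_sum => w wU; rewrite (bigD1 w) //= [in X in _ <= X](bigD1 w) //= link_self.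
have : \sum_(u in U | u != w)
    (1 + (ncdeg w <= 1) * (ncdeg u <= 1) + (ncdeg w == 0) * (ncdeg u == 0)) <=
  \sum_(u in U | u != w) link w u.
  by apply: leq_sum => u /andP[uU uw]; apply: link_low; rewrite 1?eq_sym.
by case: (ncdeg w <= 1); case: (ncdeg w == 0) => /=; lia.
Qed.

Lemma counting_contradiction : False.
Proof.
have q3 := low_size.
have A := deficiency_low.
have B := sum_low_degree.
(* a busy vertex has i <= 1 low neighbours, and 3 (2 - i) <= 2 (q - i) if q >= 3 *)
have D3 : 3 * \sum_(v in V) (2 - degin v U) <= 2 * \sum_(v in V) (#|U| - degin v U).
  rewrite !big_distrr; apply: leq_sum => v vV /=.
  by have := busy_degin_low vV; lia.
have Cc : 4 * #|U| <= \sum_(u in U) (ncdeg u + degin u C).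
  rewrite mulnC -sum_nat_const; apply: leq_sum => u uU.
  by rewrite addnC noncubic_degree // (subsetP low_sub).
(* i ^ 2 <= 2 i + 3 [i = 3] for every i <= 3 *)
have I2 : \sum_(v in C) degin v U ^ 2 <=
    2 * \sum_(u in U) degin u C + 3 * \sum_(v in C) (degin v U == 3).
  rewrite (degin_exchange U C) !big_distrr -big_split; apply: leq_sum => v vC /=.
  have := degin_disjoint v low_sub single_sub low_single_disjoint.
  rewrite degin_cubic // => h.
  have : degin v U <= 3 by lia.
  by case: (degin v U) => [|[|[|[|]]]].
have := sum_link_ge; rewrite sum_link /= => L.
have E : 2 * #|U| <= \sum_(u in U) ncdeg u + #|[set w in U | ncdeg w <= 1]| +
   #|[set w in U | ncdeg w == 0]|.
  rewrite (card_setIdE U (fun w => ncdeg w <= 1)) (card_setIdE U (fun w => ncdeg w == 0)).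
  rewrite mulnC -sum_nat_const -!big_split; apply: leq_sum => u _ /=.
  by case: (ncdeg u) => [|[|]].
move: A B D3 Cc I2 L E.
have -> : \sum_(u in U) (2 * ncdeg u + degin u C) =
  2 * \sum_(u in U) ncdeg u + \sum_(u in U) degin u C.
  by rewrite big_split big_distrr.
have -> : \sum_(u in U) (ncdeg u + degin u C) =
  \sum_(u in U) ncdeg u + \sum_(u in U) degin u C by rewrite big_split.
move: (\sum_(u in U) ncdeg u) (\sum_(u in U) degin u C) (\sum_(v in C) degin v U ^ 2)
  (\sum_(v in C) (degin v U == 3)) (\sum_(v in V) (2 - degin v U))
  (\sum_(v in V) (#|U| - degin v U)) (\sum_(w in U) degin w U)
  (#|U|) (#|[set w in U | ncdeg w <= 1]|) (#|[set w in U | ncdeg w == 0]|).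
move=> b t i2 n3 d2 dq e q r x.
(* (q - 6) (q - 7) >= 0, and (y - 1) (y - 2) >= 0 below *)
have : 13 * q <= q ^ 2 + 42 by rewrite -mulnn; case: (leqP q 6) => h; nia.
have pronic y : 3 * y <= y ^ 2 + 2 by rewrite -mulnn; case: (leqP y 1) => h; nia.
have := pronic r; have := pronic x.
lia.
Qed.

End Counting.

(** * The extremal graph and the theorem *)

Lemma connectivity_ge2 (R : rcfType) (G : sgraph) : (1 < #|G|)%N ->
  (forall f : G -> R, \sum_x f x = 0 -> 0 <= gform f f) ->
  2 <= algebraic_connectivity R G.
Proof.
move=> G1 pos; apply: (@second_eigenvalue_ge _ _ _ _ (const_mx 1)) => //.
  exact: laplacian_sym.
move=> x x1; rewrite /mxform laplacian_form; apply: pos.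
apply: etrans x1; rewrite mxE [RHS](reindex _ (onW_bij _ (@enum_rank_bij G))).
by apply: eq_bigr => i _; rewrite !mxE mulr1.
Qed.

Definition bip_adj (T : finType) (A : {set T}) : rel T :=
  fun x y => (x \in A) (+) (y \in A).

Lemma bip_sym (T : finType) (A : {set T}) : symmetric (bip_adj A).
Proof. by move=> x y; rewrite /bip_adj addbC. Qed.

Lemma bip_irrefl (T : finType) (A : {set T}) : irreflexive (bip_adj A).
Proof. by move=> x; rewrite /bip_adj addbb. Qed.

Definition complete_bipartite (T : finType) (A : {set T}) : sgraph :=
  SGraph (bip_sym A) (bip_irrefl A).

Lemma complete_bipartite_degree (T : finType) (A : {set T}) (x : complete_bipartite A) :
  degree x = if x \in A then #|~: A| else #|A|.
Proof.
by case: ifP => xA; apply: eq_card => y; rewrite !inE /= /bip_adj xA ?addFb ?addTb.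
Qed.

Lemma complete_bipartite_edges (T : finType) (A : {set T}) :
  #|edges (complete_bipartite A)| = (#|A| * #|~: A|)%N.
Proof.
have := handshake (complete_bipartite A).
rewrite (bigID (mem A)) /=.
rewrite (eq_bigr (fun=> #|~: A|)) => [|x xA]; last by rewrite complete_bipartite_degree xA.
rewrite [X in (_ + X)%N](eq_bigr (fun=> #|A|)) => [|x xA]; last first.
  by rewrite complete_bipartite_degree (negPf xA).
rewrite sum_nat_const.
rewrite (eq_bigl (fun x => x \in ~: A)) => [|x]; last by rewrite inE.
rewrite sum_nat_const; lia.
Qed.

(** Let s be the sum of f over A, so that the sum over the complement is -s.  The form
equals [(#|~: A| - 2) * \sum_(x in A) f x ^ 2 + 2 s ^ 2]. *)
Lemma complete_bipartite_form (R : rcfType) (T : finType) (A : {set T}) (f : complete_bipartite A -> R) :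
  #|A| = 2%N -> (1 < #|~: A|)%N -> \sum_x f x = 0 -> 0 <= gform f f.
Proof.
move=> A2 B2; rewrite (bigID (mem A)) /= => /eqP; rewrite addr_eq0 => /eqP sf.
set s := \sum_(x in A) f x in sf; set t := \sum_(x | x \notin A) f x in sf.
have nb x : \sum_(y | bip_adj A x y) f y = if x \in A then t else s.
  by case: ifP => xA; apply: eq_bigl => y; rewrite /bip_adj xA.
rewrite /gform (bigID (mem A)) /=.
have -> : \sum_(x | x \notin A) f x * lap2 f x = - (t * s).
  rewrite -mulNr -sumrN mulr_suml; apply: eq_bigr => x xA.
  by rewrite /lap2 complete_bipartite_degree nb (negPf xA) A2; ring.
have -> : \sum_(x in A) f x * lap2 f x =
    \sum_(x in A) (#|~: A|%:R - 2) * f x ^+ 2 - s * t.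
  rewrite /s mulr_suml -sumrB; apply: eq_bigr => x xA.
  by rewrite /lap2 complete_bipartite_degree nb xA; ring.
rewrite -addrA; apply: addr_ge0; last first.
  by rewrite sf mulNr mulrN !opprK addr_ge0 // -expr2 sqr_ge0.
by apply: sumr_ge0 => x _; rewrite mulr_ge0 ?sqr_ge0 // subr_ge0 ler_nat.
Qed.

Lemma exists_connectivity2 (R : rcfType) (n : nat) : (4 <= n)%N ->
  exists G : sgraph, [/\ #|G| = n, #|edges G| = (2 * n - 4)%N &
    2 <= algebraic_connectivity R G].
Proof.
case: n => [|[|m]] // m2.
pose A : {set 'I_m.+2} := [set ord0; ord_max].
have A2 : #|A| = 2%N by rewrite cards2.
have B2 : #|~: A| = m by have := cardsC A; rewrite A2 card_ord; lia.
exists (complete_bipartite A); split.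
- exact: card_ord.
- rewrite complete_bipartite_edges A2 B2; lia.
apply: connectivity_ge2 => [|f sf]; first by rewrite card_ord.
by apply: complete_bipartite_form => //; rewrite B2.
Qed.

Theorem theorem1p1 (R : rcfType) (n : nat) (hn : (12 <= n)%N) :
  (forall G : sgraph,
     #|G| = n -> #|edges G| = (2 * n - 4)%N ->
     algebraic_connectivity R G <= 2) /\
  is_alpha n (2 * n - 4) (2 : R).
Proof.
have upper (G : sgraph) : #|G| = n -> #|edges G| = (2 * n - 4)%N ->
    algebraic_connectivity R G <= 2.
  move=> Gn Ge; rewrite leNgt; apply/negP => /connectivity_gap2 gap.
  by apply: (counting_contradiction gap); rewrite Gn.
split=> //; split=> //.
have [|G [Gn Ge a2]] := @exists_connectivity2 R n; first exact: leq_trans hn.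
by exists G; split=> //; apply/le_anti; rewrite upper.
Qed.
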